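(* Let $F$ be an infinite field of characteristic different from $2$, $R$ a unital $F$-algebra, $G$ a group with identity $\epsilon$, and $A=M_n(R)$ with a $G$-grading such that (identifying $r\in R$ with the scalar matrix $\mathrm{diag}(r,\dots,r)$) $R$ is a homogeneous subalgebra of $A$ with $R\subseteq A_\epsilon$, and $M_n(F)$ is a homogeneous subalgebra of $A$. Suppose that $R$ has a regular grading by an abelian group $H$ such that for any two monomials $m_1,m_2\in F\langle X_H\rangle$, in distinct variables, that are not $H$-graded identities for $R$, the product $m_1m_2$ is not an $H$-graded identity for $R$. If the algebra $B=M_n(F)$, with the inherited $G$-grading $B_g=A_g\cap B$, satisfies the primeness property for graded central polynomials, then $A$ also satisfies the primeness property for graded central polynomials.
   Context: A grading by a group $G$ on an associative algebra $A$ is a vector space decomposition $A=\oplus_{g\in G}A_g$ with $A_gA_h\subseteq A_{gh}$. A subalgebra $B$ is homogeneous if $B=\oplus_{g}(A_g\cap B)$. $F\langle X_G\rangle$ is the free associative algebra on the variables $x_{i,g}$ ($i\in\mathbb{N}$, $g\in G$), where $x_{i,g}$ has degree $g$ (similarly $F\langle X_H\rangle$). For $f(x_{1,g_1},\dots,x_{m,g_m})\in F\langle X_G\rangle$, an admissible substitution is a tuple $(a_1,\dots,a_m)$ with $a_i\in A_{g_i}$. $f$ is a graded polynomial identity for $A$ if it vanishes under all admissible substitutions; $f$ is a graded central polynomial for $A$ if it is not a graded identity and all its values under admissible substitutions lie in the centre $Z(A)$. $A$ has the primeness property for graded central polynomials if, whenever $f,g\in F\langle X_G\rangle$ are polynomials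 in distinct (disjoint sets of) variables and $f\cdot g$ is a graded central polynomial for $A$, then both $f$ and $g$ are graded central polynomials for $A$. A grading $R=\oplus_{h\in H}R_h$ by an abelian group $H$ is regular if there is a commutation function $\beta:H\times H\to F^\times$ such that (P1) for every $n$ and every $(h_1,\dots,h_n)\in H^n$ there exist $r_j\in R_{h_j}$ with $r_1\cdots r_n\neq 0$; (P2) $a_{h_1}a_{h_2}=\beta(h_1,h_2)a_{h_2}a_{h_1}$ for all $h_1,h_2\in H$, $a_{h_1}\in R_{h_1}$, $a_{h_2}\in R_{h_2}$. *)

(* Defs.v *)
From HB Require Import structures.
From mathcomp Require Import all_boot all_fingroup all_algebra.
From mathcomp Require Import finmap.
From mathcomp Require Import monalg.

Set Implicit Arguments.
Unset Strict Implicit.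
Unset Printing Implicit Defensive.

Import GRing.Theory.
Local Open Scope ring_scope.

(* M_n(R) as an F-algebra, for R an F-algebra: [matalg R n] is 'M[R]_n.+1 (so
   the size of the matrices is n.+1 >= 1). The alias is needed because MathComp
   makes 'M[R]_n.+1 a module over R itself, and R is not commutative here. *)
Definition matalg (F : fieldType) (R : algType F) (n : nat) : Type :=
  'M[R]_n.+1.

Section MatAlg.
Context (F : fieldType) (R : algType F) (n : nat).

HB.instance Definition _ := GRing.NzRing.copy (matalg R n) 'M[R]_n.+1.

Definition matalg_scale (c : F) (M : matalg R n) : matalg R n :=
  map_mx (fun r : R => c *: r) M.

Fact matalg_scaleA a b M :
  matalg_scale a (matalg_scale b M) = matalg_scale (a * b) M.
Proof. by apply/matrixP => i j; rewrite !mxE scalerA. Qed.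

Fact matalg_scale1 : left_id 1 matalg_scale.
Proof. by move=> M; apply/matrixP => i j; rewrite mxE scale1r. Qed.

Fact matalg_scaleDr : right_distributive matalg_scale +%R.
Proof. by move=> a M N; apply/matrixP => i j; rewrite !mxE scalerDr. Qed.

Fact matalg_scaleDl M : {morph matalg_scale^~ M : a b / a + b}.
Proof. by move=> a b; apply/matrixP => i j; rewrite !mxE scalerDl. Qed.

HB.instance Definition _ := GRing.Zmodule_isLmodule.Build F (matalg R n)
  matalg_scaleA matalg_scale1 matalg_scaleDr matalg_scaleDl.

Fact matalg_scaleAl (a : F) (M N : matalg R n) : a *: (M * N) = a *: M * N.
Proof.
apply/matrixP => i j; rewrite !mxE scaler_sumr.
by apply: eq_bigr => k _; rewrite !mxE scalerAl.
Qed.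

HB.instance Definition _ :=
  GRing.Lmodule_isLalgebra.Build F (matalg R n) matalg_scaleAl.

Fact matalg_scaleAr (a : F) (M N : matalg R n) : a *: (M * N) = M * (a *: N).
Proof.
apply/matrixP => i j; rewrite !mxE scaler_sumr.
by apply: eq_bigr => k _; rewrite !mxE scalerAr.
Qed.

HB.instance Definition _ :=
  GRing.Lalgebra_isAlgebra.Build F (matalg R n) matalg_scaleAr.

Definition scalar_embed (r : R) : matalg R n := r%:M.

Definition base_embed (b : 'M[F]_n.+1) : matalg R n :=
  map_mx (fun c : F => c%:A : R) b.

End MatAlg.

Definition subspace (F : fieldType) (V : lmodType F) (S : V -> Prop) : Prop :=
  S 0 /\ (forall (c : F) (u v : V), S u -> S v -> S (c *: u + v)).

Definition subalgebra (F : fieldType) (A : algType F) (S : A -> Prop) : Prop :=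
  subspace S /\ (forall u v : A, S u -> S v -> S (u * v)).

Definition in_sum (F : fieldType) (G : eqType) (A : lmodType F)
    (V : G -> A -> Prop) (a : A) : Prop :=
  exists (s : seq G) (c : G -> A),
    [/\ uniq s, forall g, V g (c g) & a = \sum_(g <- s) c g].

Definition independent (F : fieldType) (G : eqType) (A : lmodType F)
    (V : G -> A -> Prop) : Prop :=
  forall (s : seq G) (c : G -> A), uniq s -> (forall g, V g (c g)) ->
    \sum_(g <- s) c g = 0 -> forall g, g \in s -> c g = 0.

Record grading (F : fieldType) (A : algType F) (G : groupType)
    (gr : G -> A -> Prop) : Prop := Grading {
  grading_subspace : forall g, subspace (gr g);
  grading_independent : independent gr;
  grading_sum : forall a : A, in_sum gr a;
  grading_mul : forall (g h : G) (a b : A),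
    gr g a -> gr h b -> gr (g * h)%g (a * b) }.

(* Directness of the sum of the gr g :&: B is inherited from the grading. *)
Definition homogeneous_subalgebra (F : fieldType) (A : algType F)
    (G : groupType) (gr : G -> A -> Prop) (B : A -> Prop) : Prop :=
  subalgebra B /\
  (forall b, B b -> in_sum (fun g a => gr g a /\ B a) b).

(* The free unital associative algebra F<X_G>: the monoid algebra of the free
   monoid on the variables x_(i,g), i : nat, g : G. *)
Definition var (G : groupType) : Type := (nat * G)%type.
HB.instance Definition _ (G : groupType) := Choice.copy (var G) (nat * G)%type.

Notation free_alg F G := {malg F[{fmonom (var G)}]}.

Definition monomial (F : fieldType) (G : groupType)
  (m : {fmonom (var G)}) : free_alg F G := << m >>.

Definition occurs (F : fieldType) (G : groupType) (x : var G)
    (f : free_alg F G) : Prop :=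
  exists2 m : {fmonom (var G)}, m \in msupp f & x \in (m : seq (var G)).

Definition disjoint_vars (F : fieldType) (G : groupType)
    (f g : free_alg F G) : Prop :=
  forall x : var G, ~ (occurs x f /\ occurs x g).

Definition eval (F : fieldType) (A : algType F) (G : groupType)
    (a : var G -> A) (f : free_alg F G) : A :=
  mmap (in_alg A)
    (fun m : {fmonom (var G)} => \prod_(x <- (m : seq (var G))) a x) f.

(* A substitution assigns a value to every variable, not only to those that
   occur in a given polynomial; since 0 lies in every component, every
   admissible tuple extends to such a substitution. *)
Definition admissible (F : fieldType) (A : algType F) (G : groupType)
    (gr : G -> A -> Prop) (a : var G -> A) : Prop :=
  forall x : var G, gr x.2 (a x).

Definition graded_identity (F : fieldType) (A : algType F) (G : groupType)
    (gr : G -> A -> Prop) (f : free_alg F G) : Prop :=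
  forall a, admissible gr a -> eval a f = 0.

Definition central (A : nzRingType) (z : A) : Prop :=
  forall y : A, z * y = y * z.

Definition graded_central (F : fieldType) (A : algType F) (G : groupType)
    (gr : G -> A -> Prop) (f : free_alg F G) : Prop :=
  ~ graded_identity gr f /\
  (forall a, admissible gr a -> central (eval a f)).

Definition primeness_property (F : fieldType) (A : algType F) (G : groupType)
    (gr : G -> A -> Prop) : Prop :=
  forall f g : free_alg F G, disjoint_vars f g ->
    graded_central gr (f * g) ->
    graded_central gr f /\ graded_central gr g.

Definition regular_grading (F : fieldType) (R : algType F) (H : groupType)
    (gr : H -> R -> Prop) : Prop :=
  grading gr /\
  exists beta : H -> H -> F,
    [/\ forall h k, beta h k != 0,
        forall (n : nat) (h : 'I_n -> H), exists r : 'I_n -> R,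
          (forall j, gr (h j) (r j)) /\ \prod_(j < n) r j != 0 &
        forall (h k : H) (a b : R),
          gr h a -> gr k b -> a * b = beta h k *: (b * a)].

Definition monomial_condition (F : fieldType) (R : algType F) (H : groupType)
    (gr : H -> R -> Prop) : Prop :=
  forall m1 m2 : {fmonom (var H)},
    disjoint_vars (monomial F m1) (monomial F m2) ->
    ~ graded_identity gr (monomial F m1) ->
    ~ graded_identity gr (monomial F m2) ->
    ~ graded_identity gr (monomial F m1 * monomial F m2).

(* Main.v *)
From HB Require Import structures.
Require Import Defs.
From mathcomp Require Import all_boot all_fingroup all_algebra.
From mathcomp Require Import finmap monalg.
From mathcomp.classical Require boolp.

(* Every element of A_g is a sum of tensors r_k b_k with r_k in R homogeneous for
   H and b_k in B_g. Substituting such sums in f and reordering the r_k by beta,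
   f becomes a sum of terms u(r) p(b), one for each multidegree; as F is infinite,
   each term lies in the span V_f of the values of f. The monomial condition and
   the primeness property of B show that, for all the u that are not identities,
   the values p(b) are central in B, and that the nonzero terms u(r) p(b) commute
   with R_l up to one and the same character chi(l).
   That chi is trivial follows from V_f being stable under [t, _] for t in R: if
   t is in R_l and chi(l) <> 1, then t u(r) p(b) is in V_f as well, hence has the
   character chi, whence beta(l, _) = 1, so that t is central and chi(l) = 1. *)

Set Implicit Arguments.
Unset Strict Implicit.
Unset Printing Implicit Defensive.

Import GRing.Theory.
Local Open Scope ring_scope.

(** * Subspaces and interpolation *)

Section Subspaces.
Context (F : fieldType) (V : lmodType F).
Implicit Types (W P : V -> Prop).

Lemma subspaceZ W c v : subspace W -> W v -> W (c *: v).
Proof. by move=> [W0 WS] Wv; rewrite -[_ *: _]addr0; apply: WS. Qed.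

Lemma subspaceD W u v : subspace W -> W u -> W v -> W (u + v).
Proof. by move=> [_ WS] Wu Wv; rewrite -[u]scale1r; apply: WS. Qed.

Lemma subspaceB W u v : subspace W -> W u -> W v -> W (u - v).
Proof.
by move=> WS Wu Wv; rewrite -scaleN1r; apply: subspaceD => //; apply: subspaceZ.
Qed.

Lemma subspace_sum W (I : Type) (r : seq I) (Q : pred I) (f : I -> V) :
  subspace W -> (forall i, Q i -> W (f i)) -> W (\sum_(i <- r | Q i) f i).
Proof.
move=> WS Wf; apply: (big_ind W) => //; first by case: WS.
by move=> u v; apply: subspaceD.
Qed.

(** Taken as the intersection of all subspaces containing [P], so that induction over the span is
    mere application. *)
Definition linspan P (v : V) : Prop :=
  forall W, subspace W -> (forall u, P u -> W u) -> W v.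

Lemma linspan_subspace P : subspace (linspan P).
Proof.
split=> [W [] // | c u v Pu Pv W WS PW].
by apply: WS.2; [apply: Pu | apply: Pv].
Qed.

Lemma linspan_ind P W : subspace W -> (forall u, P u -> W u) ->
  forall v, linspan P v -> W v.
Proof. by move=> WS PW v; apply. Qed.

Lemma sub_linspan P v : P v -> linspan P v.
Proof. by move=> Pv W _; apply. Qed.

End Subspaces.

Section Interpolation.
Context (F : fieldType).
Hypothesis F_infinite : forall s : seq F, exists c : F, c \notin s.

Lemma infinite_uniq_seq N : exists2 s : seq F, size s = N & uniq s.
Proof.
elim: N => [|N [s szs us]]; first by exists [::].
by have [c cs] := F_infinite s; exists (c :: s); rewrite /= ?szs ?cs.
Qed.

(** The weights form column [k] of the inverse of the Vandermonde matrix on [N] distinct nodes. *)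
Lemma interpolation_weights N (k : 'I_N) : exists s c : 'I_N -> F,
  forall j : 'I_N, \sum_i c i * s i ^+ j = (j == k)%:R.
Proof.
have [l szl ul] := infinite_uniq_seq N.
pose a := \row_(i < N) l`_i; pose M := Vandermonde N a.
have Mu : M \in unitmx.
  rewrite unitmxE det_Vandermonde unitfE.
  apply/prodf_neq0 => i _; apply/prodf_neq0 => j ij.
  by rewrite !mxE subr_eq0 nth_uniq ?szl // gtn_eqF.
exists (fun i => a 0 i), (fun i => invmx M i k) => j.
have := congr1 (fun A : 'M_N => A j k) (mulmxV Mu); rewrite !mxE => <-.
by apply: eq_bigr => i _; rewrite !mxE mulrC.
Qed.

Context (V : lmodType F) (W : V -> Prop).
Hypothesis WS : subspace W.

(** Weighted values at distinct scalars isolate one coefficient of a polynomial function with values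
    in [W]. *)
Lemma subspace_coef (I : eqType) (r : seq I) (e : I -> nat) (v : I -> V) :
  (forall s : F, W (\sum_(i <- r) s ^+ e i *: v i)) ->
  forall k, W (\sum_(i <- r | e i == k) v i).
Proof.
(* [N] exceeds [k] and every exponent occurring in [r], so each of them is a legal index for the
   weights. *)
move=> Wr k; pose N := (k + \sum_(i <- r) e i).+1.
have kN : (k < N)%N by rewrite ltnS leq_addr.
have [s [c sc]] := interpolation_weights (Ordinal kN).
have -> : \sum_(i <- r | e i == k) v i =
    \sum_j c j *: \sum_(i <- r) s j ^+ e i *: v i.
  under [RHS]eq_bigr => j _ do rewrite scaler_sumr.
  rewrite exchange_big big_mkcond /= !big_seq; apply: eq_bigr => i ir.
  have iN : (e i < N)%N.
    by rewrite ltnS (big_rem i) //= addnA addnAC leq_addl.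
  under eq_bigr => j _ do rewrite scalerA.
  rewrite -scaler_suml (sc (Ordinal iN)) -val_eqE /=.
  by case: eqP; rewrite (scale1r, scale0r).
by apply: subspace_sum => // j _; apply: subspaceZ.
Qed.

(** The word [w i] lists the variables of a commutative monomial with multiplicity. The variables
    are separated one at a time by [subspace_coef]. *)
Lemma subspace_multicoef (I : eqType) (r : seq I) (w : I -> seq nat)
    (v : I -> V) :
  (forall t : nat -> F, W (\sum_(i <- r) (\prod_(j <- w i) t j) *: v i)) ->
  forall d, W (\sum_(i <- r | perm_eq (w i) d) v i).
Proof.
move=> Wr d; pose same n i :=
  all (fun j => count_mem j (w i) == count_mem j d) (iota 0 n).
have Wn n t : W (\sum_(i <- r | same n i) (\prod_(j <- w i) t j) *: v i).
  elim: n t => [|n IHn] t; first exact: Wr.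
  under eq_bigl => i do rewrite /same -addn1 iotaD all_cat /= andbT.
  rewrite -big_filter_cond.
  apply: (subspace_coef (e := fun i => count_mem n (w i))) => s.
  (* Scaling the variable [n] by [s] brings out [s] to the power of its multiplicity. *)
  have := IHn (fun j => if j == n then s * t j else t j).
  rewrite big_filter; congr W; apply: eq_bigr => i _.
  rewrite scalerA; congr (_ *: _); elim: (w i) => [|j u IHu].
    by rewrite !big_nil mulr1.
  rewrite !big_cons IHu /=; case: eqP => _ /=; last by rewrite mulrCA.
  by rewrite add1n exprS -!mulrA; congr (_ * _); rewrite mulrCA.
(* For [n] beyond every index in sight, equal multiplicities below [n] amount to [perm_eq]. *)
pose n := (\max_(j <- d ++ flatten [seq w i | i <- r]) j).+1.
have := Wn n (fun=> 1); congr W; rewrite big_seq_cond [RHS]big_seq_cond.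
apply: eq_big => [i | i _]; last by rewrite big1 ?scale1r.
apply: andb_id2l => ir; apply/allP/idP => [same_i|/seq.permP pe j _]; last exact/eqP/pe.
apply/allP => j; rewrite mem_cat => jwd; apply: same_i.
rewrite mem_iota add0n /= ltnS.
have jin : j \in d ++ flatten [seq w i | i <- r].
  rewrite mem_cat; case/orP: jwd => [jw|->//]; apply/orP; right.
  by apply/flattenP; exists (w i) => //; apply: map_f.
exact: (@leq_bigmax_seq _ _ xpredT id).
Qed.

End Interpolation.

(** * Evaluation and tensors *)

Section Evaluation.
Context (F : fieldType) (A : algType F) (G : groupType).
Implicit Types (f g : free_alg F G) (a : var G -> A) (m : {fmonom (var G)}).

Lemma evalE a f :
  eval a f = \sum_(m <- msupp f) f@_m *: \prod_(x <- (m : seq (var G))) a x.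
Proof. by apply: eq_bigr => m _; rewrite mulr_algl. Qed.

Lemma eval_sum a (I : Type) (r : seq I) (P : pred I) (c : I -> F)
    (m : I -> {fmonom (var G)}) :
  eval a (\sum_(i <- r | P i) << c i *g m i >>) =
  \sum_(i <- r | P i) c i *: \prod_(x <- (m i : seq (var G))) a x.
Proof.
rewrite /eval raddf_sum /=; apply: eq_bigr => i _.
by rewrite mmapU mulr_algl.
Qed.

Lemma eval_monomial a m :
  eval a (monomial F m) = \prod_(x <- (m : seq (var G))) a x.
Proof. by rewrite /eval mmapU mulr_algl scale1r. Qed.

(** Coefficients are mapped to scalars, which commute with everything; this makes [mmap]
    multiplicative although [A] need not be commutative. *)
Lemma evalM a f g : eval a (f * g) = eval a f * eval a g.
Proof.
pose h m := \prod_(x <- (m : seq (var G))) a x.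
have hM : mmorphism h.
  by split=> [m1 m2|]; rewrite /h ?fmM ?big_cat // fm1 big_nil.
pose hm : {mmorphism {fmonom (var G)} -> A} :=
  HB.pack h (isMultiplicative.Build _ _ h hM).
have hmC (p : free_alg F G) m1 m2 : GRing.comm (in_alg A p@_m1) (hm m2).
  by rewrite /GRing.comm /= mulr_algl -scalerAr mulr1.
exact: (commr_mmap_is_multiplicative hmC).1.
Qed.

Lemma eval_ext a b f : (forall x, occurs x f -> a x = b x) -> eval a f = eval b f.
Proof.
move=> ab; rewrite !evalE !big_seq; apply: eq_bigr => m mf.
by congr (_ *: _); rewrite !big_seq; apply: eq_bigr => x xm; apply: ab; exists m.
Qed.

End Evaluation.

Section Tensor.
Context (F : fieldType) (R : algType F) (n : nat).
Implicit Types (r s : R) (b c : 'M[F]_n.+1).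

(** The pure tensor of [r] and [b] under the isomorphism of M_n(R) with the tensor product of R and
    M_n(F). *)
Definition tens r b : matalg R n := map_mx (fun x : F => x *: r) b.

Lemma tensE r b : tens r b = scalar_embed n r * base_embed R b.
Proof.
apply/matrixP => i j; rewrite !mxE (bigD1 i) //= big1 ?addr0 => [|k /negPf ki].
  by rewrite !mxE eqxx mulr1n mulr_algr.
by rewrite !mxE eq_sym ki mulr0n mul0r.
Qed.

Lemma tens1r b : tens 1 b = base_embed R b. Proof. by []. Qed.

Lemma tensr1 r : tens r 1 = scalar_embed n r.
Proof.
apply/matrixP => i j; rewrite !mxE.
by case: eqP; rewrite ?mulr1n ?scale1r ?mulr0n ?scale0r.
Qed.

Lemma tensM r s b c : tens r b * tens s c = tens (r * s) (b * c).
Proof.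
apply/matrixP => i j; rewrite !mxE scaler_suml; apply: eq_bigr => k _.
by rewrite !mxE -scalerAl -scalerAr scalerA.
Qed.

Lemma tensDl b : {morph tens^~ b : r s / r + s}.
Proof. by move=> r s; apply/matrixP => i j; rewrite !mxE scalerDr. Qed.

Lemma tensDr r : {morph tens r : b c / b + c}.
Proof. by move=> b c; apply/matrixP => i j; rewrite !mxE scalerDl. Qed.

Lemma tensBl b : {morph tens^~ b : r s / r - s}.
Proof. by move=> r s; apply/matrixP => i j; rewrite !mxE scalerBr. Qed.

Lemma tensBr r : {morph tens r : b c / b - c}.
Proof. by move=> b c; apply/matrixP => i j; rewrite !mxE scalerBl. Qed.

Lemma tens0r b : tens 0 b = 0.
Proof. by apply/matrixP => i j; rewrite !mxE scaler0. Qed.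

Lemma tensr0 r : tens r 0 = 0.
Proof. by apply/matrixP => i j; rewrite !mxE scale0r. Qed.

Lemma tensZl k r b : tens (k *: r) b = k *: tens r b.
Proof. by apply/matrixP => i j; rewrite !mxE !scalerA mulrC. Qed.

Lemma tensZr k r b : tens r (k *: b) = k *: tens r b.
Proof. by apply/matrixP => i j; rewrite !mxE scalerA. Qed.

Lemma tens_suml (I : Type) (l : seq I) (P : pred I) (r : I -> R) b :
  tens (\sum_(i <- l | P i) r i) b = \sum_(i <- l | P i) tens (r i) b.
Proof. exact: (big_morph (tens^~ b) (tensDl b) (tens0r b)). Qed.

Lemma tens_sumr (I : Type) (l : seq I) (P : pred I) r (b : I -> 'M[F]_n.+1) :
  tens r (\sum_(i <- l | P i) b i) = \sum_(i <- l | P i) tens r (b i).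
Proof. exact: (big_morph (tens r) (tensDr r) (tensr0 r)). Qed.

Lemma tens_eq0 r b : tens r b = 0 -> r != 0 -> b = 0.
Proof.
move=> /matrixP rb r0; apply/matrixP => i j; have := rb i j.
by rewrite !mxE => /eqP; rewrite scaler_eq0 (negPf r0) orbF => /eqP.
Qed.

Lemma tens_prod (I : Type) (l : seq I) (r : I -> R) (b : I -> 'M[F]_n.+1) :
  \prod_(i <- l) tens (r i) (b i) = tens (\prod_(i <- l) r i) (\prod_(i <- l) b i).
Proof.
elim: l => [|i l IHl]; last by rewrite !big_cons IHl tensM.
by rewrite !big_nil tensr1.
Qed.

Lemma matalg_sum_tens (a : matalg R n) :
  a = \sum_i \sum_j tens (a i j) (delta_mx i j).
Proof.
apply/matrixP => i j; rewrite summxE (bigD1 i) //= summxE (bigD1 j) //= !mxE.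
rewrite !eqxx scale1r !big1 ?addr0 // => [k /negPf ki | k /negPf kj].
  by rewrite summxE big1 // => l _; rewrite !mxE eq_sym ki scale0r.
by rewrite !mxE eqxx eq_sym kj scale0r.
Qed.

(** Testing against [tens 1 c] gives the tensor of [r] with the commutator of [b] and [c], and
    [tens_eq0] cancels [r]. *)
Lemma central_tensr r b :
  central (tens r b) -> r != 0 -> central b.
Proof.
move=> rbC r0 c; apply/eqP; rewrite -subr_eq0; apply/eqP/(tens_eq0 (r := r)) => //.
have := rbC (tens 1 c); rewrite !tensM mulr1 mul1r => /eqP.
by rewrite -subr_eq0 -tensBr => /eqP.
Qed.

Lemma central_tensl r b : central (tens r b) -> b != 0 -> central r.
Proof.
move=> rbC b0 s; apply/eqP; rewrite -subr_eq0; apply: contraT => rs.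
have := rbC (tens s 1); rewrite !tensM mulr1 mul1r => /eqP.
rewrite -subr_eq0 -tensBl => /eqP /tens_eq0 /(_ rs) bz.
by rewrite bz eqxx in b0.
Qed.

End Tensor.

(** Commutation with the matrix unit [delta_mx 0 i], read at entry (0, j), equates b_ij with b_00 if
    i = j and with 0 otherwise. *)
Lemma central_mx (F : fieldType) (n : nat) (b : 'M[F]_n.+1) :
  central b -> exists c : F, b = c%:M.
Proof.
move=> bC; exists (b 0 0); apply/matrixP => i j.
have /matrixP/(_ 0 j) := bC (delta_mx 0 i); rewrite !mxE.
rewrite (bigD1 0) //= big1 => [|k k0]; last by rewrite !mxE (negPf k0) /= mulr0.
rewrite (bigD1 i) //= big1 => [|k ki]; last by rewrite !mxE (negPf ki) andbF mul0r.
rewrite !mxE !eqxx /= mul1r !addr0 => <-.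
by rewrite eq_sym; case: eqP => _; rewrite ?mulr1 ?mulr0.
Qed.

(** * Spans of values *)

Section Variables.
Context (F : fieldType) (G : groupType).
Implicit Types (f g : free_alg F G).

Definition fvars f : seq (var G) := flatten [seq fmonom_val m | m <- msupp f].

Lemma occursP x f : reflect (occurs x f) (x \in fvars f).
Proof.
apply: (iffP flattenP) => [[_ /mapP[m mf ->] xm] | [m mf xm]]; first by exists m.
by exists (m : seq (var G)) => //; apply: map_f.
Qed.

(** Substitutions chosen separately for [f] and [g] in disjoint variables glue to one, so [f * g]
    takes every product of their values. *)
Definition merge_on f (X : Type) (a b : var G -> X) (x : var G) : X :=
  if x \in fvars f then a x else b x.

Context (A : algType F) (gr : G -> A -> Prop).

Lemma admissible_merge f a b :
  admissible gr a -> admissible gr b -> admissible gr (merge_on f a b).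
Proof. by move=> aa ab x; rewrite /merge_on; case: ifP. Qed.

Lemma eval_mergel f (a b : var G -> A) : eval (merge_on f a b) f = eval a f.
Proof. by apply: eval_ext => x /occursP xf; rewrite /merge_on xf. Qed.

Lemma eval_merger f g (a b : var G -> A) :
  disjoint_vars f g -> eval (merge_on f a b) g = eval b g.
Proof.
move=> fg; apply: eval_ext => x xg; rewrite /merge_on.
by case: occursP => // xf; case: (fg x).
Qed.

Lemma eval_mergeM f g (a b : var G -> A) : disjoint_vars f g ->
  eval (merge_on f a b) (f * g) = eval a f * eval b g.
Proof. by move=> fg; rewrite evalM eval_mergel eval_merger. Qed.

Definition value_span f : A -> Prop :=
  linspan (fun v => exists2 a, admissible gr a & v = eval a f).

Lemma eval_value_span f a : admissible gr a -> value_span f (eval a f).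
Proof. by move=> aa; apply: sub_linspan; exists a. Qed.

Lemma central_subspace : subspace (@central A).
Proof.
split=> [y | c u v uC vC y]; first by rewrite mulr0 mul0r.
by rewrite mulrDl mulrDr -scalerAl -scalerAr uC vC.
Qed.

Lemma value_span_central f g u v : disjoint_vars f g ->
  (forall a, admissible gr a -> central (eval a (f * g))) ->
  value_span f u -> value_span g v -> central (u * v).
Proof.
move=> fg fgC fu; move: v.
apply: linspan_ind => [|_ [b bA ->]].
  split=> [|c w w' wC w'C]; first by rewrite mulr0; apply: central_subspace.1.
  by rewrite mulrDr -scalerAr; apply: central_subspace.2.
move: u fu; apply: linspan_ind => [|_ [a aA ->]].
  split=> [|c w w' wC w'C]; first by rewrite mul0r; apply: central_subspace.1.
  by rewrite mulrDl -scalerAl; apply: central_subspace.2.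
by rewrite -eval_mergeM //; apply/fgC/admissible_merge.
Qed.

(* The linear coefficient in s of f(a + s [t, a]) is [t, f(a)], because
   [t, _] is a derivation. *)
Lemma eval_inner_derivation f (a : var G -> A) (t : A) : exists p : {poly A},
  [/\ p`_1 = t * eval a f - eval a f * t &
      forall s : F, p.[s%:A] = eval (fun x => a x + s *: (t * a x - a x * t)) f].
Proof.
pose q x : {poly A} := (a x)%:P + (t * a x - a x * t) *: 'X.
(* As [A] need not be commutative, products of polynomials are evaluated at the central points
   [s%:A] only. *)
have algC (s : F) (y : A) : s%:A * y = y * s%:A.
  by rewrite mulr_algl mulr_algr.
have qw (w : seq (var G)) : let p := \prod_(x <- w) q x in
  let aw := \prod_(x <- w) a x in
  [/\ p`_0 = aw, p`_1 = t * aw - aw * t & forall s : F,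
    p.[s%:A] = \prod_(x <- w) (a x + s *: (t * a x - a x * t))].
  elim: w => [|x w] /=.
    rewrite !big_nil !coef1 mulr1 mul1r subrr; split=> // s.
    by rewrite big_nil hornerC.
  rewrite !big_cons; set p := \prod_(_ <- _) _; set aw := \prod_(_ <- _) _.
  move=> [p0 p1 ps]; split=> [||s].
  - by rewrite coef0M p0 coefD coefC coefZ coefX mulr0 addr0.
  - rewrite coefM big_ord_recl big_ord1 /= p0 p1 !coefD !coefC !coefZ !coefX /=.
    rewrite mulr0 mulr1 addr0 add0r mulrBl mulrBr !mulrA addrC.
    by rewrite addrA subrK.
  rewrite hornerM_comm; last by rewrite /comm_poly algC.
  by rewrite ps big_cons hornerD hornerC hornerZ hornerX mulr_algr.
exists (\sum_(m <- msupp f) (f@_m)%:A *: \prod_(x <- (m : seq (var G))) q x).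
split=> [|s].
  rewrite coef_sum evalE mulr_sumr mulr_suml -sumrB; apply: eq_bigr => m _.
  have [_ p1 _] := qw (m : seq (var G)).
  by rewrite coefZ p1 mulr_algl scalerBr scalerAr scalerAl.
rewrite horner_sum evalE; apply: eq_bigr => m _.
have [_ _ ps] := qw (m : seq (var G)).
by rewrite hornerZ ps mulr_algl.
Qed.

Hypothesis F_infinite : forall s : seq F, exists c : F, c \notin s.

(** As [t] has neutral degree, a + s [t, a] is admissible with a for every scalar s. The span thus
    contains all values of a polynomial in s, hence its linear coefficient [t, f(a)]. *)
Lemma value_span_commutator f t v : grading gr -> gr 1%g t ->
  value_span f v -> value_span f (t * v - v * t).
Proof.
move=> grA tA.
have WS : subspace (value_span f) by apply: linspan_subspace.
move: v; apply: linspan_ind => [|_ [a aA ->]].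
  split=> [|c u u' Wu Wu']; first by rewrite mulr0 mul0r subrr; apply: WS.1.
  rewrite mulrDr mulrDl opprD addrACA -scalerAr -scalerAl -scalerBr.
  exact: WS.2.
have [p [<- ps]] := eval_inner_derivation f a t.
(* The bound [(size p).+2] makes 1 a legal index even when [p] is zero. *)
have := @subspace_coef _ F_infinite _ _ WS 'I_(size p).+2
   (index_enum _) val (fun i => p`_i).
move=> /(_ _ 1%N); rewrite (big_pred1 (Ordinal (isT : 1 < (size p).+2)%N)) //.
apply=> s; apply: sub_linspan.
exists (fun x => a x + s *: (t * a x - a x * t)) => [x|].
  rewrite addrC; apply: (grading_subspace grA x.2).2; last exact: aA.
  apply: subspaceB; first exact: (grading_subspace grA x.2).
    by rewrite -[x.2]mul1g; apply: (grading_mul grA).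
  by rewrite -[x.2]mulg1; apply: (grading_mul grA).
rewrite -ps (@horner_coef_wide _ (size p).+2) ?leqW //.
by apply: eq_bigr => i _; rewrite exprZn expr1n mulr_algr.
Qed.

End Variables.

(** * Decompositions along families of subspaces *)

Section Components.
Context (F : fieldType) (A : lmodType F) (G : eqType).
Implicit Types (T : G -> A -> Prop).

Lemma big_sub_uniq (s t : seq G) (c : G -> A) : uniq s -> uniq t ->
  {subset s <= t} -> \sum_(g <- t) (if g \in s then c g else 0) = \sum_(g <- s) c g.
Proof.
move=> us ut st; rewrite -big_mkcond /= -big_filter; apply: perm_big.
apply: uniq_perm; rewrite ?filter_uniq // => g.
by rewrite mem_filter andb_idr // => /st.
Qed.

Lemma in_sum_subspace T : (forall g, subspace (T g)) -> subspace (in_sum T).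
Proof.
move=> TS; split=> [|c u v [s [d [us Td ->]]] [s' [d' [us' Td' ->]]]].
  exists [::], (fun=> 0); split=> // [g|]; last by rewrite big_nil.
  exact: (TS g).1.
exists (undup (s ++ s')), (fun g => c *: (if g \in s then d g else 0) +
  (if g \in s' then d' g else 0)); split; first exact: undup_uniq.
- by move=> g; apply: (TS g).2; case: ifP => // _; apply: (TS g).1.
rewrite big_split -scaler_sumr /= !big_sub_uniq ?undup_uniq // => g gs.
  by rewrite mem_undup mem_cat gs orbT.
by rewrite mem_undup mem_cat gs.
Qed.

(** When the subspaces [T g] of the [V g] already fill the space, uniqueness of the decomposition
    along [V] forces them to be equal. *)
Lemma in_sum_component T (V : G -> A -> Prop) : independent V ->
  (forall g, subspace (V g)) -> (forall g, subspace (T g)) ->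
  (forall g a, T g a -> V g a) -> (forall a, in_sum T a) ->
  forall g a, V g a -> T g a.
Proof.
move=> Vind VS TS TV TA g a Va; have [s [d [us Td aE]]] := TA a.
pose d0 h := if h \in s then d h else 0.
have Td0 h : T h (d0 h) by rewrite /d0; case: ifP => // _; apply: (TS h).1.
suff <- : d0 g = a by [].
apply/eqP; rewrite -subr_eq0; apply/eqP.
(* [dg] decomposes [a] by its single term at [g]; its difference with [d0] sums to zero. *)
pose dg h := if h \in [:: g] then a else 0.
have := Vind (undup (g :: s)) (fun h => d0 h - dg h) (undup_uniq _).
move=> /(_ _ _ g); rewrite mem_undup mem_head {3}/dg mem_head; apply=> //.
  move=> h; apply: subspaceB => //; first exact: TV.
  by rewrite /dg inE; case: eqP => [-> // | _]; apply: (VS h).1.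
rewrite sumrB !big_sub_uniq ?undup_uniq //.
- by rewrite big_seq1 -aE subrr.
- by move=> h; rewrite mem_undup !inE => ->.
by move=> h hs; rewrite mem_undup inE hs orbT.
Qed.

End Components.

(** * Multihomogeneous components *)

Section BigLists.

Lemma partition_big_seq (I J : eqType) (V : nmodType) (r : seq I) (k : I -> J)
    (E : I -> V) :
  \sum_(i <- r) E i =
  \sum_(d <- undup [seq k i | i <- r]) \sum_(i <- r | k i == d) E i.
Proof.
rewrite (exchange_big_dep xpredT) //= !big_seq; apply: eq_bigr => i ir.
rewrite -big_filter (_ : [seq d <- _ | k i == d] = [:: k i]) ?big_seq1 //.
rewrite (eq_filter (a2 := pred1 (k i))) => [|d]; last by rewrite eq_sym.
by rewrite filter_pred1_uniq ?undup_uniq // mem_undup map_f.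
Qed.

Lemma scale_prod_seq (F : fieldType) (R : algType F) (I : Type) (l : seq I)
    (t : I -> F) (r : I -> R) :
  \prod_(i <- l) (t i *: r i) = (\prod_(i <- l) t i) *: \prod_(i <- l) r i.
Proof.
elim: l => [|i l IHl]; first by rewrite !big_nil scale1r.
by rewrite !big_cons IHl -scalerAl -scalerAr scalerA.
Qed.

(** The words that arise when a product of sums over [w] is multiplied out, [code x k] naming the
    k-th summand at [x]. *)
Fixpoint expand_word (X : Type) (K : X -> nat) (code : X -> nat -> nat)
    (w : seq X) : seq (seq nat) :=
  if w is x :: w' then
    [seq code x k :: v | k <- iota 0 (K x), v <- expand_word K code w']
  else [:: [::]].

Lemma prod_expand_word (S : nzRingType) (X : Type) (K : X -> nat) code
    (w : seq X) (y : nat -> S) :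
  \prod_(x <- w) \sum_(k <- iota 0 (K x)) y (code x k) =
  \sum_(v <- expand_word K code w) \prod_(j <- v) y j.
Proof.
elim: w => [|x w IHw] /=; first by rewrite big_seq1 !big_nil.
rewrite big_cons IHw big_allpairs_dep mulr_suml; apply: eq_bigr => k _.
by rewrite mulr_sumr; apply: eq_bigr => v _; rewrite big_cons.
Qed.

Lemma mem_expand_word (X : eqType) (K : X -> nat) code (w : seq X) v j :
  v \in expand_word K code w -> j \in v -> exists x k, j = code x k.
Proof.
elim: w v => [|x w IHw] v /=; first by rewrite inE => /eqP ->.
case/allpairsP => -[k v'] /= [_ v'w ->]; rewrite inE.
by case/predU1P => [->|]; [exists x, k | apply: IHw].
Qed.

Lemma occurs_sum (F : fieldType) (G : groupType) (I : eqType) (r : seq I)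
    (P : pred I) (c : I -> F) (m : I -> {fmonom (var G)}) x :
  occurs x (\sum_(i <- r | P i) << c i *g m i >>) ->
  exists2 i, i \in r & P i /\ x \in (m i : seq (var G)).
Proof.
case=> k; rewrite -mcoeff_neq0 raddf_sum /= => /eqP k0 xk.
apply: boolp.contrapT => ni; apply: k0; rewrite big_seq_cond big1 // => i.
case/andP=> ir Pi; rewrite mcoeffU; case: eqP => // mk.
by case: ni; exists i => //; split=> //; rewrite mk.
Qed.

End BigLists.

Section Reordering.
Context (F : fieldType) (R : algType F) (H : groupType) (Rgr : H -> R -> Prop).
Context (beta : H -> H -> F).
Hypothesis R_comm : forall (h k : H) (a b : R),
  Rgr h a -> Rgr k b -> a * b = beta h k *: (b * a).
Context (I : eqType) (eta : I -> H).

Lemma prod_commute_r (s : seq I) (r : I -> R) l t :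
  (forall i, Rgr (eta i) (r i)) -> Rgr l t ->
  (\prod_(i <- s) r i) * t =
    (\prod_(i <- s) beta (eta i) l) *: (t * \prod_(i <- s) r i).
Proof.
move=> rR tl; elim: s => [|i s IHs].
  by rewrite !big_nil scale1r mulr1 mul1r.
rewrite !big_cons -mulrA IHs -scalerAr [r i * (t * _)]mulrA (R_comm (rR i) tl).
by rewrite -scalerAl scalerA mulrC mulrA.
Qed.

(** The scalar depends only on the degrees [eta], so one [c] serves all [r]; [part_component] relies
    on this to make it a coefficient of a polynomial. *)
Lemma perm_prod_scalar (w d : seq I) : perm_eq w d -> exists c : F,
  forall r : I -> R, (forall i, Rgr (eta i) (r i)) ->
    \prod_(i <- w) r i = c *: \prod_(i <- d) r i.
Proof.
rewrite perm_sym => pdw.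
pose P w := exists c : F, forall r : I -> R,
  (forall i, Rgr (eta i) (r i)) ->
  \prod_(i <- w) r i = c *: \prod_(i <- d) r i.
(* Any rearrangement is reached by swaps of adjacent blocks, so one such swap has to be treated. *)
suff: P w by []; apply: (@catCA_perm_ind _ P) pdw _; last first.
  by exists 1 => r _; rewrite scale1r.
move=> s1 s2 s3 [c cE].
have [c' c'E] : exists c' : F, forall r : I -> R,
    (forall i, Rgr (eta i) (r i)) ->
    (\prod_(i <- s2) r i) * (\prod_(i <- s1) r i) =
    c' *: ((\prod_(i <- s1) r i) * (\prod_(i <- s2) r i)).
  elim: s1 {cE} => [|i s1 [c' c'E]].
    by exists 1 => r _; rewrite !big_nil scale1r mulr1 mul1r.
  exists ((\prod_(j <- s2) beta (eta j) (eta i)) * c') => r rR.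
  rewrite !big_cons mulrA (prod_commute_r s2 rR (rR i)) -scalerAl.
  rewrite -(mulrA (r i) (\prod_(_ <- s2) _)).
  by rewrite c'E // -scalerAr scalerA mulrA.
exists (c' * c) => r rR.
by rewrite -scalerA -cE // !big_cat /= mulrA c'E // -scalerAl mulrA.
Qed.

End Reordering.

Section HomogeneousComponents.
Context (F : fieldType) (R : algType F) (G : groupType) (n : nat).
Context (Agr : G -> matalg R n -> Prop).
Hypothesis F_infinite : forall s : seq F, exists c : F, c \notin s.
Hypothesis A_graded : grading Agr.
Hypothesis R_neutral : forall r : R, Agr 1%g (scalar_embed n r).
Hypothesis B_homogeneous :
  homogeneous_subalgebra Agr (fun a => exists b : 'M[F]_n.+1, a = base_embed R b).
Context (H : groupType) (Rgr : H -> R -> Prop).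
Hypothesis R_graded : grading Rgr.
Context (beta : H -> H -> F).
Hypothesis R_comm : forall (h k : H) (a b : R),
  Rgr h a -> Rgr k b -> a * b = beta h k *: (b * a).

Definition base_grading (g : G) (b : 'M[F]_n.+1) : Prop := Agr g (base_embed R b).

Lemma Agr_tens g r b : base_grading g b -> Agr g (tens r b).
Proof. by move=> gb; rewrite tensE -[g]mul1g; apply: (grading_mul A_graded). Qed.

Lemma base_grading0 g : base_grading g 0.
Proof. by rewrite /base_grading -tens1r tensr0; apply: (grading_subspace _ g).1. Qed.

Definition tens_span (g : G) (a : matalg R n) : Prop :=
  exists l : seq (H * R * 'M[F]_n.+1),
    (forall p, p \in l -> Rgr p.1.1 p.1.2 /\ base_grading g p.2) /\
    a = \sum_(p <- l) tens p.1.2 p.2.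

Lemma tens_span_subspace g : subspace (tens_span g).
Proof.
split=> [|c u v [l [lP ->]] [l' [lP' ->]]]; first by exists [::]; rewrite big_nil.
exists ([seq (p.1.1, c *: p.1.2, p.2) | p <- l] ++ l'); split=> [p|].
  rewrite mem_cat => /orP[/mapP[q ql ->] | /lP' //] /=.
  have [Rq Bq] := lP _ ql; split=> //.
  by apply: subspaceZ => //; apply: grading_subspace.
rewrite big_cat big_map scaler_sumr; congr (_ + _).
by apply: eq_bigr => p _; rewrite tensZl.
Qed.

(** Splitting the entries of a matrix along H, and the matrix units along G inside M_n(F), writes it
    as a sum of elements of the [tens_span g]. As these lie in the [Agr g], they exhaust them. *)
Lemma grading_tens_span g a : Agr g a -> tens_span g a.
Proof.
apply: (in_sum_component (grading_independent A_graded)).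
- exact: grading_subspace.
- exact: tens_span_subspace.
- move=> h _ [l [lP ->]]; rewrite big_seq.
  apply: subspace_sum; first exact: grading_subspace.
  by move=> p /lP[_ Bp]; apply: Agr_tens.
move=> {g} a; have TS := in_sum_subspace tens_span_subspace.
rewrite (matalg_sum_tens a).
do 2![apply: subspace_sum => // ? _].
move: (a _ _) (delta_mx _ _) => r b.
have [s [c [us cB bE]]] := B_homogeneous.2 (base_embed R b) (ex_intro _ b erefl).
have [d dE] := boolp.choice (fun g => (cB g).2).
exists s, (fun g => tens r (d g)); split=> // [g|].
  have [s' [c' [us' Rc' ->]]] := grading_sum R_graded r.
  exists [seq (h, c' h, d g) | h <- s']; split=> [p /mapP[h _ ->]|].
    by split=> //=; rewrite /base_grading -dE; apply: (cB g).1.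
  by rewrite big_map tens_suml.
rewrite tensE bE mulr_sumr; apply: eq_bigr => g _.
by rewrite tensE dE.
Qed.

(* The polynomial [p] together with the monomial [u] records a multihomogeneous
   component of [f] under the substitution of sums of tensors [r_k b_k]: the [r]
   are collected in [u] at the cost of scalars which [p] absorbs. The parity of
   the indices keeps the components of two polynomials in disjoint variables. *)
Definition component (f : free_alg F G) (odd_idx : bool) (u : seq (var H))
    (p : free_alg F G) : Prop :=
  [/\ forall rho b, admissible Rgr rho -> admissible base_grading b ->
        value_span Agr f (tens (\prod_(x <- u) rho x) (eval b p)),
      forall x, x \in u -> odd x.1 = odd_idx &
      forall x, occurs x p -> odd x.1 = odd_idx].

Definition component_span f odd_idx : matalg R n -> Prop :=
  linspan (fun v => exists u p rho b, [/\ component f odd_idx u p,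
    admissible Rgr rho, admissible base_grading b &
    v = tens (\prod_(x <- u) rho x) (eval b p)]).

Section Decomposition.
Context (f : free_alg F G) (odd_idx : bool).
Context (l : var G -> seq (H * R * 'M[F]_n.+1)).
Hypothesis lP : forall x p,
  p \in l x -> Rgr p.1.1 p.1.2 /\ base_grading x.2 p.2.

(** One natural number encodes a variable of [f] together with a position in its list; the lowest
    bit is [odd_idx], and [decode] drops it. *)
Let code (x : var G) (k : nat) : nat :=
  (odd_idx + (choice.pickle (index x (fvars f), k)).*2)%N.
Let decode (j : nat) : nat * nat := odflt (0, 0)%N (choice.unpickle j./2).
Let src (j : nat) : var G := nth (0%N, 1%g) (fvars f) (decode j).1.
Let entry (j : nat) := nth (1%g, 0, 0) (l (src j)) (decode j).2.
Let eta (j : nat) : H := (entry j).1.1.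

Let src_code x k : x \in fvars f -> src (code x k) = x.
Proof.
by move=> xf; rewrite /src /decode half_bit_double choice.pickleK /= nth_index.
Qed.

Let entry_code x k : x \in fvars f -> entry (code x k) = nth (1%g, 0, 0) (l x) k.
Proof.
by move=> xf; rewrite /entry src_code // /decode half_bit_double choice.pickleK.
Qed.

Let odd_code x k : odd (code x k) = odd_idx.
Proof. by rewrite /code oddD odd_double oddb addbF. Qed.

Let entryP j : Rgr (eta j) (entry j).1.2 /\ base_grading (src j).2 (entry j).2.
Proof.
rewrite /eta /entry; set p := nth _ _ _.
(* A position out of range reads the default, whose two zeros lie in every component. *)
have [|out] := ltnP (decode j).2 (size (l (src j))); last first.
  rewrite /p nth_default //=; split; last exact: base_grading0.
  exact: (grading_subspace R_graded _).1.
by move=> /(mem_nth (1%g, 0, 0)) /lP.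
Qed.

(** The multiplied-out form of [f] at the sums given by [l]: coefficients with words of codes. *)
Let L : seq (F * seq nat) := [seq (f@_m, v) | m <- msupp f,
  v <- expand_word (fun x => size (l x)) code (m : seq (var G))].

(** A multidegree is a list [d] up to permutation. *)
Let part (d : seq nat) (r : nat -> R) (b : nat -> 'M[F]_n.+1) : matalg R n :=
  \sum_(i <- L | perm_eq i.2 d)
    i.1 *: tens (\prod_(j <- i.2) r j) (\prod_(j <- i.2) b j).

Let subst (r : nat -> R) (b : nat -> 'M[F]_n.+1) (x : var G) : matalg R n :=
  if x \in fvars f then
    \sum_(k <- iota 0 (size (l x))) tens (r (code x k)) (b (code x k))
  else 0.

Let odd_L i j : i \in L -> j \in i.2 -> odd j = odd_idx.
Proof.
case/allpairsPdep => m [v [_ vm ->]] /= jv.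
by have [x [k ->]] := mem_expand_word vm jv.
Qed.

Let eval_subst r b : eval (subst r b) f =
  \sum_(i <- L) i.1 *: tens (\prod_(j <- i.2) r j) (\prod_(j <- i.2) b j).
Proof.
rewrite evalE big_allpairs_dep !big_seq; apply: eq_bigr => m mf /=.
rewrite -scaler_sumr; congr (_ *: _).
under [RHS]eq_bigr => v _ do rewrite -tens_prod.
rewrite -prod_expand_word !big_seq; apply: eq_bigr => x xm.
by rewrite /subst (introT (occursP _ _)) //; exists m.
Qed.

Let admissible_subst r b : (forall j, base_grading (src j).2 (b j)) ->
  admissible Agr (subst r b).
Proof.
move=> bB x; rewrite /subst; case: ifP => [xf|_].
  apply: subspace_sum; first exact: grading_subspace.
  by move=> k _; apply: Agr_tens; rewrite -{1}(src_code k xf).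
exact: (grading_subspace A_graded _).1.
Qed.

(** Scaling each [r j] by its own [t j] keeps the substitution admissible and multiplies a word by
    its monomial in [t], so [subspace_multicoef] extracts the part. *)
Let part_value_span d r b : (forall j, base_grading (src j).2 (b j)) ->
  value_span Agr f (part d r b).
Proof.
move=> bB; apply: (subspace_multicoef F_infinite).
  exact: linspan_subspace.
move=> t; have := @eval_value_span _ _ _ _ f _
  (admissible_subst (fun j => t j *: r j) bB).
rewrite eval_subst; congr value_span; apply: eq_bigr => i _.
by rewrite scale_prod_seq tensZl !scalerA mulrC.
Qed.

(** All words in a part are rearrangements of [d], hence their products of [r] are multiples of one
    product, and the multipliers go into the coefficients of [p]. *)
Let part_component d : (forall j, j \in d -> odd j = odd_idx) ->
  exists u p, component f odd_idx u p /\
    exists rho b, [/\ admissible Rgr rho, admissible base_grading b &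
      part d (fun j => (entry j).1.2) (fun j => (entry j).2) =
      tens (\prod_(x <- u) rho x) (eval b p)].
Proof.
move=> d_odd.
(* Stated for all words [w], so that [boolp.choice] yields one function [c]. *)
have reorder w : exists c : F, perm_eq w d ->
    forall r, (forall j, Rgr (eta j) (r j)) ->
      \prod_(j <- w) r j = c *: \prod_(j <- d) r j.
  case: (boolP (perm_eq w d)) => [pwd|_]; last by exists 0.
  by have [c cE] := perm_prod_scalar R_comm eta pwd; exists c.
have [c cE] := boolp.choice reorder.
pose gamma j : var G := (j, (src j).2).
pose u := [seq (j, eta j) : var H | j <- d].
pose p : free_alg F G := \sum_(i <- L | perm_eq i.2 d)
  << i.1 * c i.2 *g FMonom [seq gamma j | j <- i.2] >>.
have partE r b : (forall j, Rgr (eta j) (r (j, eta j))) ->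
    tens (\prod_(x <- u) r x) (eval b p) =
    part d (fun j => r (j, eta j)) (fun j => b (gamma j)).
  move=> rR; rewrite /p eval_sum tens_sumr; apply: eq_bigr => i pid.
  rewrite (cE _ pid) // !big_map.
  by rewrite tensZl tensZr scalerA.
exists u, p; split; first split=> [r b rR bB | x /mapP[j jd ->] | x].
- rewrite partE => [|j]; last by have := rR (j, eta j).
  exact: (part_value_span d _ (fun j => bB (gamma j))).
- exact: d_odd.
- case/occurs_sum => i iL [_ /mapP[j ji ->]]; exact: odd_L iL ji.
(* Admissibility concerns all variables; those whose degree does not match their index get 0, which
   lies in every component. *)
pose rho (x : var H) := if x.2 == eta x.1 then (entry x.1).1.2 else 0.
pose b (x : var G) := if x.2 == (src x.1).2 then (entry x.1).2 else 0.
have rhoR : admissible Rgr rho.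
  move=> x; rewrite /rho; case: eqP => [->|_]; first exact: (entryP _).1.
  exact: (grading_subspace R_graded _).1.
exists rho, b; split=> // [x|].
  rewrite /b; case: eqP => [->|_]; first exact: (entryP _).2.
  exact: base_grading0.
rewrite partE => [|j]; last by have := rhoR (j, eta j).
by apply: eq_bigr => i _; congr (_ *: tens _ _); apply: eq_bigr => j _;
  rewrite /rho /b /= eqxx.
Qed.

Lemma decomposition a : (forall x, a x = \sum_(p <- l x) tens p.1.2 p.2) ->
  component_span f odd_idx (eval a f).
Proof.
move=> aE.
have -> : eval a f = eval (subst (fun j => (entry j).1.2) (fun j => (entry j).2)) f.
  apply: eval_ext => x /occursP xf; rewrite aE /subst xf (big_nth (1%g, 0, 0)).
  by rewrite /index_iota subn0; apply: eq_bigr => k _; rewrite entry_code.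
(* Sorting picks one representative of each multidegree, so that no part is counted twice. *)
rewrite eval_subst (partition_big_seq _ (fun i => sort leq i.2)).
rewrite big_seq; apply: subspace_sum; first exact: linspan_subspace.
move=> d; rewrite mem_undup => /mapP[i0 i0L ->].
have d_odd j : j \in sort leq i0.2 -> odd j = odd_idx.
  by rewrite mem_sort; apply: odd_L.
have [u [p [cup [rho [b [rR bB E]]]]]] := part_component d_odd.
apply: sub_linspan; exists u, p, rho, b; split=> //; rewrite -E.
apply: eq_bigl => i; rewrite perm_sym perm_sort perm_sym.
by apply/eqP/idP => /(perm_sortP leq_total leq_trans anti_leq).
Qed.

End Decomposition.

Lemma value_span_components f odd_idx v :
  value_span Agr f v -> component_span f odd_idx v.
Proof.
move: v; apply: linspan_ind => [|_ [a aA ->]]; first exact: linspan_subspace.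
have [l lP] := boolp.choice (fun x => grading_tens_span (aA x)).
by apply: (decomposition (l := l)) => x; have [] := lP x.
Qed.

End HomogeneousComponents.

(** * The character of the values *)

Section RegularGrading.
Context (F : fieldType) (R : algType F) (H : groupType) (Rgr : H -> R -> Prop).
Hypothesis R_graded : grading Rgr.
Context (beta : H -> H -> F).
Hypothesis beta_neq0 : forall h k, beta h k != 0.
Hypothesis R_prod_neq0 : forall (n : nat) (h : 'I_n -> H), exists r : 'I_n -> R,
  (forall j, Rgr (h j) (r j)) /\ \prod_(j < n) r j != 0.
Hypothesis R_comm : forall (h k : H) (a b : R),
  Rgr h a -> Rgr k b -> a * b = beta h k *: (b * a).
Hypothesis R_monomials : monomial_condition Rgr.
Implicit Types u w : seq (var H).

Definition nonidentity_word u : Prop :=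
  exists2 rho, admissible Rgr rho & \prod_(x <- u) rho x != 0.

Lemma nonidentity_wordP u :
  nonidentity_word u <-> ~ graded_identity Rgr (monomial F (FMonom u)).
Proof.
split=> [[rho rR rho_u] /(_ rho rR)|].
  by rewrite eval_monomial => /eqP; apply/negP.
move=> nid; apply: boolp.contrapT => nu; apply: nid => rho rR.
by rewrite eval_monomial; apply: boolp.contrapT => /eqP rho_u; apply: nu; exists rho.
Qed.

Lemma occurs_monomial (m : {fmonom (var H)}) x :
  occurs x (monomial F m) -> x \in (m : seq (var H)).
Proof. by case=> k; rewrite msuppU1 inE => /eqP ->. Qed.

Lemma nonidentity_word_cat u w : (forall x, x \in u -> x \notin w) ->
  nonidentity_word u -> nonidentity_word w -> nonidentity_word (u ++ w).
Proof.
move=> uw /nonidentity_wordP nu /nonidentity_wordP nw.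
have dis : disjoint_vars (monomial F (FMonom u)) (monomial F (FMonom w)).
  by move=> x [/occurs_monomial /uw /negP xw /occurs_monomial].
apply: boolp.contrapT => nuw; apply: (R_monomials dis nu nw) => rho rR.
rewrite evalM !eval_monomial -big_cat /=.
by apply: boolp.contrapT => /eqP rho_uw; apply: nuw; exists rho.
Qed.

(** An index above all those in [w] makes [x] fresh, [R_prod_neq0] with one factor makes it a
    nonidentity, and the monomial condition passes this on to the product. *)
Lemma nonidentity_word_cons w l : nonidentity_word w ->
  exists2 x : var H, x.2 = l & nonidentity_word (x :: w).
Proof.
move=> nw; exists ((\max_(x <- w) x.1).+1, l) => //.
rewrite -cat1s; apply: nonidentity_word_cat => // [x|].
  rewrite inE => /eqP ->; apply/negP => xw.
  by have := @leq_bigmax_seq _ w xpredT fst _ xw isT; rewrite /= ltnn.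
have [r [rl r0]] := R_prod_neq0 (fun _ : 'I_1 => l).
exists (fun x => if x.2 == l then r ord0 else 0) => [x|].
  case: eqP => [->|_]; [exact: rl | exact: (grading_subspace R_graded _).1].
by rewrite big_seq1 /= eqxx; move: r0; rewrite big_ord1.
Qed.

(** The factor that arises when a value of [w] is moved past an element of degree [l]. *)
Definition char_word w (l : H) : F := \prod_(x <- w) beta x.2 l.

Lemma char_word_neq0 w l : char_word w l != 0.
Proof. by rewrite /char_word; elim/big_rec: _ => *; rewrite ?oner_neq0 ?mulf_neq0. Qed.

Lemma word_commute w rho l t : admissible Rgr rho -> Rgr l t ->
  (\prod_(x <- w) rho x) * t = char_word w l *: (t * \prod_(x <- w) rho x).
Proof. by move=> rR tl; apply: (prod_commute_r R_comm). Qed.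

Lemma commute_homogeneous (z : R) :
  (forall l t, Rgr l t -> z * t = t * z) -> central z.
Proof.
move=> zC y; have [s [c [_ cR ->]]] := grading_sum R_graded y.
by rewrite mulr_sumr mulr_suml; apply: eq_bigr => h _; apply: zC (cR h).
Qed.

Lemma char_word_cat u w l : char_word (u ++ w) l = char_word u l * char_word w l.
Proof. exact: big_cat. Qed.

(** A fresh variable of degree [l] supplies t with t z nonzero for a value z of [w]. Then z t is
    both t z and the factor times t z. *)
Lemma central_char_word w l : nonidentity_word w ->
  (forall rho, admissible Rgr rho -> central (\prod_(x <- w) rho x)) ->
  char_word w l = 1.
Proof.
move=> nw wC; have [x xl [rho rR]] := nonidentity_word_cons l nw.
rewrite big_cons => nz; have tl : Rgr l (rho x) by rewrite -xl.
have := word_commute w rR tl; rewrite (wC _ rR) => /eqP.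
rewrite -{1}[rho x * _]scale1r -subr_eq0 -scalerBl scaler_eq0 (negPf nz) orbF.
by rewrite subr_eq0 => /eqP.
Qed.

End RegularGrading.

(** * From components to central values *)

Section Transfer.
Context (F : fieldType) (R : algType F) (G : groupType) (n : nat).
Context (Agr : G -> matalg R n -> Prop).
Hypothesis F_infinite : forall s : seq F, exists c : F, c \notin s.
Hypothesis A_graded : grading Agr.
Hypothesis R_neutral : forall r : R, Agr 1%g (scalar_embed n r).
Hypothesis B_homogeneous :
  homogeneous_subalgebra Agr (fun a => exists b : 'M[F]_n.+1, a = base_embed R b).
Context (H : groupType) (Rgr : H -> R -> Prop).
Hypothesis R_graded : grading Rgr.
Context (beta : H -> H -> F).
Hypothesis beta_neq0 : forall h k, beta h k != 0.
Hypothesis R_prod_neq0 : forall (n : nat) (h : 'I_n -> H), exists r : 'I_n -> R,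
  (forall j, Rgr (h j) (r j)) /\ \prod_(j < n) r j != 0.
Hypothesis R_comm : forall (h k : H) (a b : R),
  Rgr h a -> Rgr k b -> a * b = beta h k *: (b * a).
Hypothesis R_monomials : monomial_condition Rgr.

Let Bgr : G -> 'M[F]_n.+1 -> Prop := base_grading Agr.
Let comp := component Agr Rgr.

(** An induction principle: tensors with a zero factor vanish, so only components with a nonidentity
    word and a nonzero matrix value have to be checked. *)
Lemma tens_span_components f odd_idx (W : matalg R n -> Prop) : subspace W ->
  (forall u p rho b, comp f odd_idx u p -> admissible Rgr rho ->
     admissible Bgr b -> nonidentity_word Rgr u -> eval b p != 0 ->
     W (tens (\prod_(x <- u) rho x) (eval b p))) ->
  forall v, value_span Agr f v -> W v.
Proof.
move=> WS WC v fv.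
have := value_span_components F_infinite A_graded R_neutral B_homogeneous R_graded
  R_comm (odd_idx := odd_idx) fv.
move: v {fv}.
apply: linspan_ind => // _ [u [p [rho [b [cup rR bB ->]]]]].
have [->|b0] := eqVneq (eval b p) 0; first by rewrite tensr0; apply: WS.1.
have [->|r0] := eqVneq (\prod_(x <- u) rho x) 0.
  by rewrite tens0r; apply: WS.1.
by apply: WC => //; exists rho.
Qed.

(** Opposite parities make [u] and [w] disjoint, so [u ++ w] is a nonidentity. In a central tensor,
    a factor is central as soon as the other one is nonzero. *)
Lemma component_product_central f g u p w q :
  (forall v v', value_span Agr f v -> value_span Agr g v' -> central (v * v')) ->
  comp f false u p -> comp g true w q -> nonidentity_word Rgr u ->
  nonidentity_word Rgr w ->
  forall b c, admissible Bgr b -> admissible Bgr c ->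
    central (eval b p * eval c q) /\
    (eval b p * eval c q != 0 ->
     forall l, char_word beta u l * char_word beta w l = 1).
Proof.
move=> fgC [cp u_even _] [cq w_odd _] nu nw.
have nuw : nonidentity_word Rgr (u ++ w).
  apply: nonidentity_word_cat => // x /u_even xu; apply/negP => /w_odd.
  by rewrite xu.
move=> b c bB cB; have tC rho : admissible Rgr rho ->
    central (tens (\prod_(x <- u ++ w) rho x) (eval b p * eval c q)).
  by move=> rR; rewrite big_cat -tensM; apply: fgC; [apply: cp | apply: cq].
split=> [|pq0 l]; first by have [rho rR r0] := nuw; apply: central_tensr (tC _ rR) r0.
rewrite -char_word_cat.
apply: (central_char_word R_graded R_prod_neq0 R_comm R_monomials) => // rho rR.
exact: central_tensl (tC _ rR) pq0.
Qed.

(** Values of [f] commute with M_n(F), and with R_l up to [chi l], so the point is that [chi] is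
    trivial; the nonzero value of [p0] serves to show this. *)
Lemma central_values_of_components f odd_idx u0 p0 b0 (chi : H -> F) :
  comp f odd_idx u0 p0 -> nonidentity_word Rgr u0 -> admissible Bgr b0 ->
  eval b0 p0 != 0 ->
  (forall u p b, comp f odd_idx u p -> nonidentity_word Rgr u ->
     admissible Bgr b -> eval b p != 0 ->
     central (eval b p) /\ char_word beta u =1 chi) ->
  forall v, value_span Agr f v -> central v.
Proof.
move=> c0 nu0 b0B p0b0 compP.
have AS : subspace (value_span Agr f) by apply: linspan_subspace.
have twist l t v : Rgr l t -> value_span Agr f v ->
    v * scalar_embed n t = chi l *: (scalar_embed n t * v).
  move=> tl; move: v; apply: (tens_span_components (odd_idx := odd_idx)).
    split=> [|c v v' vE v'E]; first by rewrite mul0r mulr0 scaler0.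
    rewrite mulrDl mulrDr scalerDr -scalerAl vE v'E -scalerAr.
    by rewrite !scalerA mulrC.
  move=> u p rho b cup rR bB nu pb; have [_ uchi] := compP _ _ _ cup nu bB pb.
  by rewrite -tensr1 !tensM mulr1 mul1r (word_commute R_comm u rR tl) uchi tensZl.
have chi1 l : chi l = 1.
  apply/eqP; rewrite -subr_eq0; apply: contraT => chi_l.
  have chi_u0 k : char_word beta u0 k = chi k.
    by have [_ ->] := compP _ _ _ c0 nu0 b0B p0b0.
  (* By [twist], the commutator of t and v is (1 - chi l) t v, and the factor is invertible here. *)
  have tu_span rho t : admissible Rgr rho -> Rgr l t ->
      value_span Agr f (tens (t * \prod_(x <- u0) rho x) (eval b0 p0)).
    move=> rR tl; pose v := tens (\prod_(x <- u0) rho x) (eval b0 p0).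
    have vf : value_span Agr f v by case: c0 => c0 _ _; apply: c0.
    have := value_span_commutator F_infinite A_graded (R_neutral t) vf.
    rewrite (twist _ _ _ tl vf) -{1}[_ * v]scale1r -scalerBl.
    move/(subspaceZ (1 - chi l)^-1 AS); rewrite scalerA mulVf.
      by rewrite scale1r -tensr1 tensM mul1r.
    by rewrite subr_eq0 eq_sym -subr_eq0.
  (* Moving s of degree k past t z, with z a value of [u0], costs [chi k] by [twist] and also
     [chi k * beta l k]; fresh variables of degrees l and k keep s t z nonzero. *)
  have beta_l k : beta l k = 1.
    have [y yl ny] := nonidentity_word_cons R_graded R_prod_neq0 R_monomials l nu0.
    have [x xk [rho rR]] :=
      nonidentity_word_cons R_graded R_prod_neq0 R_monomials k ny.
    rewrite !big_cons; set z := \prod_(_ <- _) _ => nz.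
    have sk : Rgr k (rho x) by rewrite -xk.
    have tl : Rgr l (rho y) by rewrite -yl.
    have := twist _ _ _ sk (tu_span _ _ rR tl).
    rewrite -tensr1 !tensM mulr1 mul1r -mulrA (word_commute R_comm u0 rR sk) chi_u0.
    rewrite -scalerAr (mulrA (rho y)) (R_comm tl sk) -scalerAl -(mulrA (rho x)) !tensZl.
    move=> /eqP; rewrite -subr_eq0 scalerA -scalerBl -tensZl => /eqP E.
    have : (chi k * beta l k - chi k) *: (rho x * (rho y * z)) = 0.
      by apply/eqP; apply: contraNT p0b0 => /(tens_eq0 E) ->.
    move=> /eqP; rewrite scaler_eq0 (negPf nz) orbF -{2}[chi k]mulr1 -mulrBr.
    by rewrite mulf_eq0 -chi_u0 (negPf (char_word_neq0 beta_neq0 _ _)) /= subr_eq0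
       => /eqP.
  (* Now R_l is central, and a nonzero t z with z t = [chi l] t z contradicts [chi l] being
     different from 1. *)
  have [y yl [rho rR]] := nonidentity_word_cons R_graded R_prod_neq0 R_monomials l nu0.
  rewrite big_cons; set z := \prod_(_ <- _) _ => nz.
  have tl : Rgr l (rho y) by rewrite -yl.
  have tC : central (rho y).
    apply: (commute_homogeneous R_graded) => k s sk.
    by rewrite (R_comm tl sk) beta_l scale1r.
  have := word_commute R_comm u0 rR tl; rewrite -/z -tC chi_u0 => /eqP.
  rewrite eq_sym -subr_eq0 -{2}[rho y * z]scale1r -scalerBl scaler_eq0.
  by rewrite (negPf nz) orbF (negPf chi_l).
(* Matrices are sums of products of R and M_n(F), so commuting with these two suffices. *)
move=> v fv; have vR (r : R) : v * scalar_embed n r = scalar_embed n r * v.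
  have [s [c [_ cR ->]]] := grading_sum R_graded r.
  rewrite -!tensr1 tens_suml mulr_sumr mulr_suml; apply: eq_bigr => h _.
  by rewrite tensr1 (twist _ _ _ (cR h) fv) chi1 scale1r.
have vB (b : 'M[F]_n.+1) : v * base_embed R b = base_embed R b * v.
  move: v fv {vR}; apply: (tens_span_components (odd_idx := odd_idx)).
    split=> [|c v v' vE v'E]; first by rewrite mul0r mulr0.
    by rewrite mulrDl mulrDr -scalerAl vE v'E -scalerAr.
  move=> u p rho b' cup rR bB nu pb; have [pC _] := compP _ _ _ cup nu bB pb.
  by rewrite -tens1r !tensM mulr1 mul1r pC.
move=> y; rewrite (matalg_sum_tens y) mulr_sumr mulr_suml.
apply: eq_bigr => i _; rewrite mulr_sumr mulr_suml; apply: eq_bigr => j _.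
by rewrite tensE mulrA vR -mulrA vB mulrA.
Qed.

End Transfer.

(** A central matrix over a field is scalar, hence invertible when nonzero. *)
Lemma mulr_central_mx_eq0 (F : fieldType) (n : nat) (b z : 'M[F]_n.+1) :
  central z -> z != 0 -> b * z = 0 -> b = 0.
Proof.
move=> zC z0; have [c zE] := central_mx zC.
have c0 : c != 0 by apply: contraNneq z0 => c0; rewrite zE c0 raddf0.
rewrite zE -mulmxE mul_mx_scalar => /eqP.
by rewrite scaler_eq0 (negPf c0) => /eqP.
Qed.

Lemma central_mulr_cancel (F : fieldType) (n : nat) (b z : 'M[F]_n.+1) :
  central z -> z != 0 -> central (b * z) -> central b.
Proof.
move=> zC z0 bzC y; apply/eqP; rewrite -subr_eq0; apply/eqP.
apply: (mulr_central_mx_eq0 zC z0); rewrite mulrBl -[b * y * z]mulrA -zC.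
by rewrite mulrA bzC mulrA subrr.
Qed.

Theorem theorem4p12 (F : fieldType) (R : algType F) (G : groupType) (n : nat)
  (Agr : G -> matalg R n -> Prop)
  (F_infinite : forall s : seq F, exists c : F, c \notin s)
  (F_char : 2%N \notin [pchar F])
  (A_graded : grading Agr)
  (R_homogeneous :
     homogeneous_subalgebra Agr (fun a => exists r : R, a = scalar_embed n r))
  (R_neutral : forall r : R, Agr 1%g (scalar_embed n r))
  (B_homogeneous :
     homogeneous_subalgebra Agr
       (fun a => exists b : 'M[F]_n.+1, a = base_embed R b))
  (H : groupType) (Rgr : H -> R -> Prop)
  (H_abelian : forall h k : H, (h * k = k * h)%g)
  (R_regular : regular_grading Rgr)
  (R_monomials : monomial_condition Rgr)
  (B_prime :
     primeness_property
       (fun (g : G) (b : 'M[F]_n.+1) => Agr g (base_embed R b))) :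
  primeness_property Agr.
Proof.
have [R_graded [beta [beta_neq0 R_prod_neq0 R_comm]]] := R_regular.
move=> f g fg [fg_nid fg_central].
have fgC v v' : value_span Agr f v -> value_span Agr g v' -> central (v * v').
  exact: value_span_central.
(* Otherwise, by bilinearity, the product of any value of [f] with any value of [g] would vanish,
   and [f * g] would be an identity. *)
have [u [p [w [q [cup cwq nu nw [b [c [bB cB pq0]]]]]]]] : exists u p w q,
    [/\ component Agr Rgr f false u p, component Agr Rgr g true w q,
        nonidentity_word Rgr u, nonidentity_word Rgr w &
        exists b c, [/\ admissible (base_grading Agr) b,
          admissible (base_grading Agr) c & eval b p * eval c q != 0]].
  apply: boolp.contrapT => none; apply: fg_nid => a aA; rewrite evalM.
  have fa := eval_value_span (f := f) aA; have ga := eval_value_span (f := g) aA.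
  move: (eval a f) (eval a g) fa ga => v v' fv; move: v'.
  apply: (tens_span_components F_infinite A_graded R_neutral B_homogeneous
    R_graded R_comm (odd_idx := true)).
    split=> [|k v1 v2 v1E v2E]; first by rewrite mulr0.
    by rewrite mulrDr -scalerAr v1E v2E scaler0 addr0.
  move=> w q rho c cwq rR cB nw qc; move: v fv.
  apply: (tens_span_components F_infinite A_graded R_neutral B_homogeneous
    R_graded R_comm (odd_idx := false)).
    split=> [|k v1 v2 v1E v2E]; first by rewrite mul0r.
    by rewrite mulrDl -scalerAl v1E v2E scaler0 addr0.
  move=> u p sigma b cup sR bB nu pb; rewrite tensM.
  have [->|pq0] := eqVneq (eval b p * eval c q) 0; first by rewrite tensr0.
  by case: none; exists u, p, w, q; split=> //; exists b, c.
have prod_central := component_product_central R_graded R_prod_neq0 R_comm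
  R_monomials fgC.
(* Indices are even in [p] and odd in [q]. *)
have pqD : disjoint_vars p q.
  move=> x [xp xq]; case: cup cwq => _ _ /(_ x xp) + [_ _ /(_ x xq)].
  by move=> ->.
(* The primeness of B enters here: [p * q] has central values on B, among them the nonzero one found
   above. *)
have [[p_nid pC] [q_nid qC]] : graded_central (base_grading Agr) p /\
    graded_central (base_grading Agr) q.
  apply: B_prime => //; split=> [pq_id|a aB].
    have := pq_id _ (admissible_merge p bB cB).
    by rewrite eval_mergeM // => pq; rewrite pq eqxx in pq0.
  by rewrite evalM; have [] := prod_central _ _ _ _ cup cwq nu nw _ _ aB aB.
have p0 : eval b p != 0 by apply: contraNneq pq0 => ->; rewrite mul0r.
have q0 : eval c q != 0 by apply: contraNneq pq0 => ->; rewrite mulr0.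
have values_central := central_values_of_components F_infinite A_graded R_neutral
  B_homogeneous R_graded beta_neq0 R_prod_neq0 R_comm R_monomials.
split; split=> [f_id|a aA].
- by apply: fg_nid => a aA; rewrite evalM f_id // mul0r.
(* The fixed pair [w], [q] tests every component of [f]: the factors of [u'] and [w] multiply to 1,
   whence this choice of [chi]. *)
- apply: (values_central _ _ _ _ _ (fun l => (char_word beta w l)^-1)
    cup nu bB p0); last exact: eval_value_span.
  move=> u' p' b' cup' nu' bB' p0'.
  have [pqC chiE] := prod_central _ _ _ _ cup' cwq nu' nw _ _ bB' cB.
  have p'C : central (eval b' p') by apply: central_mulr_cancel (qC _ cB) q0 pqC.
  split=> // l; apply: (mulIf (char_word_neq0 beta_neq0 w l)).
  rewrite mulVf ?char_word_neq0 // chiE //.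
  by apply: contraNneq p0' => /(mulr_central_mx_eq0 (qC _ cB) q0) ->.
- by apply: fg_nid => a aA; rewrite evalM f_id // mulr0.
- apply: (values_central _ _ _ _ _ (fun l => (char_word beta u l)^-1)
    cwq nw cB q0); last exact: eval_value_span.
  move=> w' q' c' cwq' nw' cB' q0'.
  have [pqC chiE] := prod_central _ _ _ _ cup cwq' nu nw' _ _ bB cB'.
  (* Centrality of the value of [p] brings it to the right, where the cancellation lemmas expect the
     central factor. *)
  rewrite (pC _ bB) in pqC chiE.
  have q'C : central (eval c' q') by apply: central_mulr_cancel (pC _ bB) p0 pqC.
  split=> // l; apply: (mulfI (char_word_neq0 beta_neq0 u l)).
  rewrite mulfV ?char_word_neq0 // chiE //.
  by apply: contraNneq q0' => /(mulr_central_mx_eq0 (pC _ bB) p0) ->.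
Qed.
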